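(* Fix an integer $K\ge 1$ and consider the online problem $\mathrm{BMC}_{\le K}$ (defined in the context). (i) The online algorithm $\mathrm{BRB}_K$ (defined in the context) is $K$-competitive for $\mathrm{BMC}_{\le K}$: for every instance $\mathcal I$, $\mathrm{BRB}_K(\mathcal I)\le K\cdot \mathrm{OPT}(\mathcal I)$. (ii) No deterministic online algorithm for $\mathrm{BMC}_{\le K}$ is less than $K$-competitive: for every deterministic online algorithm $A$ and every real $c<K$ there is an instance $\mathcal I$ with $A(\mathcal I)> c\cdot\mathrm{OPT}(\mathcal I)$.
   Context: Bigtable merge compaction $\mathrm{BMC}_f$, for a non-decreasing read-cost function $f:\mathbb{R}_{+}\to\mathbb{R}_{+}\cup\{\infty\}$: the input is a sequence $\mathcal I=\langle(\ell_t,r_t)\rangle_{t=1}^n$ of pairs of nonnegative reals. An algorithm maintains a stack of lengths, initially empty. At time $t=1,\dots,n$ the pair $(\ell_t,r_t)$ is revealed and $\ell_t$ is pushed on top of the stack; the algorithm then chooses a compaction: it selects some nonempty contiguous sequence of lengths at the top of the stack (which includes the new $\ell_t$) and replaces them by their sum $L_t$. The merge cost at time $t$ is $L_t$ and the read cost is $r_t f(k_t)$, where $k_t$ is the stack size after the compaction at time $t$. A schedule $\sigma$ is the sequence of $n$ compactions; its cost on $\mathcal I$ is $\sigma(\mathcal I)=\sum_{t=1}^n L_t+r_t f(k_t)$ (also written $A(\mathcal I)$ for the schedule produced by algorithm $A$). $\mathrm{OPT}(\mathcal I)$ is the minimum cost of any schedule. An algorithm is online if its choice at time $t$ depends only on $(\ell_1,r_1),\dots,(\ell_t,r_t)$.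 It is $c$-competitive if $A(\mathcal I)\le c\,\mathrm{OPT}(\mathcal I)$ for every instance $\mathcal I$. $\mathrm{BMC}_{\le K}$ is $\mathrm{BMC}_f$ with $f(k)=0$ for $k\le K$ and $f(k)=\infty$ for $k>K$ (i.e., only merge costs count, and the stack must have at most $K$ entries after each compaction). Write $\ell[i,j]=\sum_{h=i}^j\ell_h$ and $\mathcal I[i,j]=(\ell_i,r_i),\dots,(\ell_j,r_j)$. Algorithm $\mathrm{BRB}_K$: for $K=1$, at every time all files are merged into one (the only feasible schedule). For $K>1$, the times $[1,n]$ are partitioned into consecutive intervals called phases. The first phase is $[1,1]$. Each subsequent phase $[s,s']$ starts at the time $s$ after the previous phase ends; during times $s,\dots,s'-1$, $\mathrm{BRB}_K$ runs $\mathrm{BRB}_{K-1}$ recursively on the requests $\mathcal I[s,\cdot]$, ignoring the single file at the bottom of the stack left by the previous phase (so it uses the other $K-1$ stack positions). The phase ends at the first time $s'\ge s$ such that $\mathrm{BRB}_{K-1}(\mathcal I[s,s'])\ge (K-1)\,\ell[1,s']$, where $\mathrm{BRB}_{K-1}(\mathcal I[s,s'])$ is the cost of $\mathrm{BRB}_{K-1}$ on $\mathcal I[s,s']$ viewed as a stand-alone $\mathrm{BMC}_{\le K-1}$ instance; at time $s'$, $\mathrm{BRB}_K$ merges all files in the stack into one (paying $\ell[1,s']$). (The last phase may end at time $n$ without such a merge.) *)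

(* Defs.v *)
From mathcomp Require Import all_boot all_order all_algebra.
From mathcomp Require Import classical_sets reals constructive_ereal ereal.

Set Implicit Arguments.
Unset Strict Implicit.
Unset Printing Implicit Defensive.

Import Order.TTheory GRing.Theory Num.Theory.
Local Open Scope classical_set_scope.
Local Open Scope ring_scope.

Section BigtableMergeCompaction.
Variable R : realType.

(* Times are 0-based: the request (l_t, r_t) is item t - 1 of an instance.
   A stack is a list of lengths whose head is the top. *)
Definition request := (R * R)%type.

Definition is_instance (I : seq request) : bool :=
  all (fun q => (0 <= q.1) && (0 <= q.2)) I.

(* A compaction is encoded by the number m of top entries it merges. *)
Definition compact (m : nat) (s : seq R) : seq R :=
  (\sum_(x <- take m s) x) :: drop m s.

(* The stack after the first t compactions. *)
Definition stack (I : seq request) (sigma : seq nat) (t : nat) : seq R :=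
  foldl (fun s p => compact p.2 (p.1.1 :: s)) [::] (take t (zip I sigma)).

Definition is_schedule (I : seq request) (sigma : seq nat) : Prop :=
  size sigma = size I /\
  forall t, (t < size I)%N ->
    (1 <= nth 0%N sigma t <= (size (stack I sigma t)).+1)%N.

(* In \bar R one has 0 * +oo = 0; an infinite value of f must forbid the stack
   size even when the request has r = 0, whence the explicit test. *)
Definition read_cost (f : R -> \bar R) (r : R) (k : nat) : \bar R :=
  if f k%:R == +oo%E then +oo%E else (r%:E * f k%:R)%E.

Definition cost (f : R -> \bar R) (I : seq request) (sigma : seq nat) :
    \bar R :=
  (\sum_(t < size I)
    ((head 0 (stack I sigma t.+1))%:E
     + read_cost f (nth (0, 0)%R I t).2 (size (stack I sigma t.+1))))%E.

(* The infimum is over a finite nonempty set, so it is a minimum. *)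
Definition OPT (f : R -> \bar R) (I : seq request) : \bar R :=
  ereal_inf [set cost f I sigma | sigma in [set sigma | is_schedule I sigma]].

Definition cap (K : nat) (x : R) : \bar R :=
  if x <= K%:R then 0%E else +oo%E.

Definition algorithm := seq request -> seq nat.

Definition is_algorithm (A : algorithm) : Prop :=
  forall I, is_instance I -> is_schedule I (A I).

Definition is_online (A : algorithm) : Prop :=
  forall (I J : seq request) (t : nat), is_instance I -> is_instance J ->
    (t < size I)%N -> (t < size J)%N -> take t.+1 I = take t.+1 J ->
    nth 0%N (A I) t = nth 0%N (A J) t.

Definition competitive (f : R -> \bar R) (c : R) (A : algorithm) : Prop :=
  forall I, is_instance I -> (cost f I (A I) <= c%:E * OPT f I)%E.

Definition total_length (I : seq request) : R := \sum_(q <- I) q.1.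

(* The stack holds (0 < t) files just before the push of item t. *)
Definition merge_all : algorithm :=
  fun I => mkseq (fun t => (0 < t)%N.+1) (size I).

(* One level of the recursion, with B the algorithm for stack size K1.
   past : all requests already handled;
   cur  : those of them that belong to the current phase;
   k    : the current stack size.
   A compaction of k.+1 entries merges the whole stack. Otherwise B's choice
   for the last request of cur is played; as it is counted from the top of the
   stack, the ignored bottom file does not affect it. *)
Fixpoint phases (K1 : nat) (B : algorithm) (past cur : seq request) (k : nat)
    (todo : seq request) : seq nat :=
  if todo is q :: todo' then
    let past' := rcons past q in
    let cur' := rcons cur q in
    if nilp past
       || ((K1%:R * total_length past')%:E <= cost (cap K1) cur' (B cur'))%E
    then k.+1 :: phases K1 B past' [::] 1 todo'
    else let m := last 0%N (B cur') in
         m :: phases K1 B past' cur' (k.+1 - m).+1 todo'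
  else [::].

(* The value at 0 is irrelevant. *)
Fixpoint BRB (K : nat) : algorithm :=
  match K with
  | (_.+1 as K1).+1 => phases K1 (BRB K1) [::] [::] 0
  | _ => merge_all
  end.

End BigtableMergeCompaction.

(* Main.v *)
(* Upper bound, by induction on K: in each phase of BRB_K, ending with total
   length L, any schedule pays at least L, since it either merges the bottom
   file or serves the phase on K - 1 slots; BRB_K pays at most K L.

   Lower bound: an adversary for k + 1 free slots pushes a file of length b and
   then runs, in successive phases with much smaller but growing lengths, the
   adversary for k free slots. A phase ends when the algorithm merges into the
   file b, which costs it b. Offline, each phase can be served in two ways:
   "rent", keeping b untouched and using k slots, for about a 1/k fraction of
   what the algorithm pays before that merge, or "buy", merging everything when
   the phase starts, for about b, after which the phase is almost free. The
   cheaper of the two is about a 1/(k + 1) fraction of the algorithm's cost. *)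
Require Import Defs.
From mathcomp Require Import all_boot all_order all_algebra.
From mathcomp Require Import boolp classical_sets reals constructive_ereal ereal.
From mathcomp Require Import zify ring lra.
Set Implicit Arguments.
Unset Strict Implicit.
Unset Printing Implicit Defensive.
Import Order.TTheory GRing.Theory Num.Theory.
Local Open Scope ring_scope.

(** * Schedules run from an arbitrary starting stack, with real-valued merge costs *)

Section Runs.
Variable R : realType.
Implicit Types (s t : seq R) (I J : seq (request R)) (q : request R)
  (sigma tau : seq nat) (K m : nat).

(** Locked so that [/=] does not unfold compactions; [pushE] opens them on demand. *)
Definition push m q s : seq R := locked (Defs.compact m (q.1 :: s)).

Lemma pushE m q s : push m q s =
  \sum_(x <- take m (q.1 :: s)) x :: drop m (q.1 :: s).
Proof. by rewrite /push -lock. Qed.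

Fixpoint run s I sigma : seq R :=
  match I, sigma with
  | q :: I', m :: sigma' => run (push m q s) I' sigma'
  | _, _ => s
  end.

Fixpoint merge_cost s I sigma : R :=
  match I, sigma with
  | q :: I', m :: sigma' =>
      head 0 (push m q s) + merge_cost (push m q s) I' sigma'
  | _, _ => 0
  end.

Fixpoint feasible K s I sigma : bool :=
  match I, sigma with
  | [::], [::] => true
  | q :: I', m :: sigma' =>
      [&& (0 < m <= (size s).+1)%N, (size (push m q s) <= K)%N
        & feasible K (push m q s) I' sigma']
  | _, _ => false
  end.

Definition nonneg s := all (fun x => 0 <= x) s.

Lemma size_push m q s : size (push m q s) = ((size s).+1 - m).+1.
Proof. by rewrite !pushE /= size_drop. Qed.

Lemma sum_push m q s : \sum_(x <- push m q s) x = q.1 + \sum_(x <- s) x.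
Proof. by rewrite !pushE big_cons -big_cat cat_take_drop big_cons. Qed.

Lemma push_full q s : push (size s).+1 q s = [:: q.1 + \sum_(x <- s) x].
Proof.
by rewrite !pushE /= take_size drop_size big_cons.
Qed.

Lemma push_rcons m q s z : (m <= (size s).+1)%N ->
  push m q (rcons s z) = rcons (push m q s) z.
Proof.
move=> lem; rewrite !pushE -rcons_cons -cats1.
rewrite takel_cat // drop_cat -cats1 /=.
case: (ltngtP m (size s).+1) lem => // -> _.
by rewrite subnn drop0 /= drop_size.
Qed.

Lemma sum_nonneg s : nonneg s -> 0 <= \sum_(x <- s) x.
Proof.
elim: s => [|x s IH] /=; rewrite ?big_nil ?big_cons // => /andP[? /IH]; lra.
Qed.

Lemma push_nonneg m q s : 0 <= q.1 -> nonneg s -> nonneg (push m q s).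
Proof.
move=> q0 s0; have h : nonneg (q.1 :: s) by rewrite /= q0.
move: h; rewrite /nonneg -{1}(cat_take_drop m (q.1 :: s)) all_cat => /andP[h1 h2].
by rewrite !pushE /= h2 andbT sum_nonneg.
Qed.

Lemma head_push_ge m q s : (0 < m)%N -> nonneg s -> q.1 <= head 0 (push m q s).
Proof.
case: m => // m _; rewrite !pushE /= big_cons => s0; rewrite lerDl sum_nonneg //.
by move: s0; rewrite /nonneg -{1}(cat_take_drop m s) all_cat => /andP[].
Qed.

Lemma is_instance_cons q I :
  is_instance (q :: I) = ((0 <= q.1) && (0 <= q.2)) && is_instance I.
Proof. by []. Qed.

Lemma is_instance_cat I J :
  is_instance (I ++ J) = is_instance I && is_instance J.
Proof. exact: all_cat. Qed.

Lemma is_instance_rcons I q :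
  is_instance (rcons I q) = is_instance I && ((0 <= q.1) && (0 <= q.2)).
Proof. by rewrite /is_instance all_rcons andbC. Qed.

Lemma run_nonneg s I sigma : is_instance I -> nonneg s ->
  nonneg (run s I sigma).
Proof.
elim: I s sigma => [|q I IH] s [|m sigma] //= /andP[/andP[q0 _] I0] s0.
exact/IH/push_nonneg.
Qed.

Lemma total_length_cons q I : total_length (q :: I) = q.1 + total_length I.
Proof. by rewrite /total_length big_cons. Qed.

Lemma total_length_cat I J :
  total_length (I ++ J) = total_length I + total_length J.
Proof. by rewrite /total_length big_cat. Qed.

Lemma total_length_ge0 I : is_instance I -> 0 <= total_length I.
Proof.
elim: I => [|q I IH]; first by rewrite /total_length big_nil.
by rewrite total_length_cons => /andP[/andP[? _] /IH]; lra.
Qed.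

Lemma feasible_size K s I sigma : feasible K s I sigma -> size sigma = size I.
Proof.
by elim: I s sigma => [|q I IH] s [|m sigma] //= /and3P[_ _ /IH ->].
Qed.

Lemma run_sum K s I sigma : feasible K s I sigma ->
  \sum_(x <- run s I sigma) x = \sum_(x <- s) x + total_length I.
Proof.
elim: I s sigma => [|q I IH] s [|m sigma] //=.
  by rewrite /total_length big_nil addr0.
by case/and3P=> _ _ /IH->; rewrite sum_push total_length_cons; ring.
Qed.

Lemma run_neq_nil s I sigma : s != [::] -> run s I sigma != [::].
Proof.
by elim: I s sigma => [|q I IH] s [|m sigma] //= _; apply: IH; rewrite pushE.
Qed.

Lemma merge_cost_ge K s I sigma : is_instance I -> nonneg s ->
  feasible K s I sigma -> total_length I <= merge_cost s I sigma.
Proof.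
elim: I s sigma => [|q I IH] s [|m sigma] //=.
  by rewrite /total_length big_nil.
move=> /andP[/andP[q0 _] I0] s0 /and3P[/andP[m0 _] _ f].
have h := IH _ _ I0 (push_nonneg m q0 s0) f.
have /= h' := head_push_ge q m0 s0.
by rewrite total_length_cons; lra.
Qed.

Lemma merge_cost_ge0 K s I sigma : is_instance I -> nonneg s ->
  feasible K s I sigma -> 0 <= merge_cost s I sigma.
Proof.
by move=> I0 s0 /(merge_cost_ge I0 s0); apply/le_trans/total_length_ge0.
Qed.

Section Cat.
Variables (s : seq R) (I J : seq (request R)) (sigma tau : seq nat).
Hypothesis sz : size sigma = size I.

Lemma run_cat : run s (I ++ J) (sigma ++ tau) = run (run s I sigma) J tau.
Proof.
by elim: I s sigma sz => [|q I' IH] s' [|m sigma'] //= [] /IH ->.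
Qed.

Lemma merge_cost_cat : merge_cost s (I ++ J) (sigma ++ tau) =
  merge_cost s I sigma + merge_cost (run s I sigma) J tau.
Proof.
elim: I s sigma sz => [|q I' IH] s' [|m sigma'] //= => [_|[] /IH ->].
  by rewrite add0r.
by rewrite addrA.
Qed.

Lemma feasible_cat K : feasible K s (I ++ J) (sigma ++ tau) =
  feasible K s I sigma && feasible K (run s I sigma) J tau.
Proof.
elim: I s sigma sz => [|q I' IH] s' [|m sigma'] //= [] /IH ->.
by rewrite !andbA.
Qed.

End Cat.

Lemma feasible_catE K s I J sigma : feasible K s (I ++ J) sigma ->
  exists tau1 tau2, [/\ sigma = tau1 ++ tau2, size tau1 = size I,
    feasible K s I tau1
    & feasible K (run s I tau1) J tau2].
Proof.
move=> f; exists (take (size I) sigma), (drop (size I) sigma).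
have sz : size (take (size I) sigma) = size I.
  by rewrite size_takel // (feasible_size f) size_cat leq_addr.
by move: f; rewrite -{1}(cat_take_drop (size I) sigma) feasible_cat // =>
  /andP[? ?]; rewrite cat_take_drop.
Qed.

(** A legal compaction of [s] never reaches a file lying below [s], so the same choices work with
    that file frozen at the bottom of one extra slot. *)
Lemma feasible_frame K s I sigma z : feasible K s I sigma ->
  [/\ feasible K.+1 (rcons s z) I sigma,
      run (rcons s z) I sigma = rcons (run s I sigma) z
    & merge_cost (rcons s z) I sigma = merge_cost s I sigma].
Proof.
elim: I s sigma => [|q I IH] s [|m sigma] //= /and3P[/andP[m0 ms] sK /IH].
move=> [f r c].
rewrite push_rcons // f r c !size_rcons m0 leqW //= ltnS sK pushE.
by split=> //; rewrite pushE.
Qed.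

(** Compactions are linear in the entries, so a factor [c] between the two stacks survives them;
    [1 <= c] covers the pushed file, which is the same on both sides. *)
Lemma merge_cost_scale c K s t I sigma : 1 <= c -> is_instance I ->
  size s = size t -> (forall i, nth 0 s i <= c * nth 0 t i) ->
  feasible K t I sigma ->
  feasible K s I sigma /\ merge_cost s I sigma <= c * merge_cost t I sigma.
Proof.
move=> c1; elim: I s t sigma => [|q I IH] s t [|m sigma] //=.
  by rewrite mulr0.
move=> /andP[/andP[q0 _] I0] sz le /and3P[h1 h2 h3].
have le' i : nth 0 (q.1 :: s) i <= c * nth 0 (q.1 :: t) i.
  by case: i => [|i] /=; [rewrite ler_peMl | exact: le].
have hd : head 0 (push m q s) <= c * head 0 (push m q t).
  rewrite !pushE /= (big_nth 0) [in leRHS](big_nth 0) !size_take /= sz mulr_sumr.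
  rewrite !big_mkord; apply: ler_sum => i _.
  have im : (i < m)%N by apply: leq_trans (ltn_ord i) _; case: ltnP.
  by rewrite !nth_take.
have szp : size (push m q s) = size (push m q t) by rewrite !size_push sz.
have lep i : nth 0 (push m q s) i <= c * nth 0 (push m q t) i.
  by case: i => [|i] //; rewrite !pushE /= !nth_drop.
have [f cc] := IH _ _ _ I0 szp lep h3.
by rewrite sz h1 szp h2 f; split=> //; lra.
Qed.

End Runs.

(** * Extended-real costs reduced to feasibility and merge cost *)

Section Cost.
Variable R : realType.
Implicit Types (s : seq R) (I J : seq (request R)) (sigma : seq nat) (K : nat).

(** Versions of [stack], [cost] and [is_schedule] from any initial stack, to allow induction on the
    requests. *)
Let stack_from s I sigma t : seq R :=
  foldl (fun s p => Defs.compact p.2 (p.1.1 :: s)) s (take t (zip I sigma)).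

Let cost_from K s I sigma : \bar R :=
  (\sum_(t < size I)
    ((head 0 (stack_from s I sigma t.+1))%:E
     + read_cost (cap K) (nth (0, 0)%R I t).2 (size (stack_from s I sigma t.+1))))%E.

Let schedule_from s I sigma : Prop :=
  size sigma = size I /\
  forall t, (t < size I)%N ->
    (1 <= nth 0%N sigma t <= (size (stack_from s I sigma t)).+1)%N.

Lemma read_cost_cap K (r : R) k :
  read_cost (cap K) r k = if (k <= K)%N then 0%E else +oo%E.
Proof. by rewrite /read_cost /cap ler_nat; case: (k <= K)%N; rewrite //= mule0. Qed.

Let cost_fromE K s I sigma : schedule_from s I sigma ->
  cost_from K s I sigma =
  if feasible K s I sigma then (merge_cost s I sigma)%:E else +oo%E.
Proof.
elim: I s sigma => [|q I IH] s [|m sigma] //=.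
- by rewrite /cost_from big_ord0.
- by case.
- by case.
move=> [/= [sz] legal].
have lm : (0 < m <= (size s).+1)%N by have := legal 0%N isT; rewrite /stack_from.
rewrite {1}/cost_from /= big_ord_recl.
rewrite (_ : \big[_/_]_(i < size I) _ = cost_from K (push m q s) I sigma);
  last first.
  by apply: eq_bigr => i _; rewrite /stack_from /= pushE.
rewrite IH; last first.
  split=> // t tI; have := legal t.+1 tI.
  by rewrite /stack_from /= pushE.
rewrite lm read_cost_cap /stack_from /= take0 /= pushE /=.
by case: ltnP => _ /=; case: ifP => _; rewrite ?adde0 -?EFinD //.
Qed.

Let feasible_legal K s I sigma : feasible K s I sigma -> schedule_from s I sigma.
Proof.
elim: I s sigma => [|q I IH] s [|m sigma] //= /and3P[m0 _ /IH[sz legal]].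
split=> /=; first by rewrite sz.
by case=> [|t] //= /legal; rewrite /stack_from /= pushE.
Qed.

Lemma feasible_schedule K I sigma :
  feasible K [::] I sigma -> is_schedule I sigma.
Proof. exact: feasible_legal. Qed.

Lemma cost_cap K I sigma : is_schedule I sigma -> cost (cap K) I sigma =
  if feasible K [::] I sigma then (merge_cost [::] I sigma)%:E else +oo%E.
Proof. exact: cost_fromE. Qed.

Lemma cost_cap_feasible K I sigma : feasible K [::] I sigma ->
  cost (cap K) I sigma = (merge_cost [::] I sigma)%:E.
Proof. by move=> f; rewrite cost_cap ?f //; exact: feasible_schedule f. Qed.

Lemma OPT_le K I sigma : feasible K [::] I sigma ->
  (OPT (cap K) I <= (merge_cost [::] I sigma)%:E)%E.
Proof.
move=> f; apply: ereal_inf_lbound; exists sigma; last exact: cost_cap_feasible.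
exact: feasible_schedule f.
Qed.

(** Schedules that break the cap cost [+oo] and do not constrain the infimum. *)
Lemma le_OPT K I (y : R) :
  (forall sigma, feasible K [::] I sigma -> y <= merge_cost [::] I sigma) ->
  (y%:E <= OPT (cap K) I)%E.
Proof.
move=> h; apply/ereal_infP => _ [sigma leg <-]; rewrite cost_cap //.
by case: ifP => [/h|_]; rewrite ?lee_fin // leey.
Qed.

End Cost.

(** * The upper bound: competitiveness of [BRB] *)

Section UpperBound.
Variable R : realType.
Implicit Types (s t : seq R) (I J : seq (request R)) (sigma tau : seq nat).

(** The shorter stack imitates the compaction of [t], truncated by [minn] to the entries it has; the
    further files merged in [t] are nonnegative, so domination persists. *)
Lemma push_dominated m (q : request R) s t : 0 <= q.1 -> nonneg t ->
  (forall i, nth 0 s i <= nth 0 t i) -> (size s < size t)%N ->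
  forall i, nth 0 (push (minn m (size s).+1) q s) i <= nth 0 (push m q t) i.
Proof.
move=> q0 t0 le sz; set m' := minn _ _.
have qt0 : nonneg (q.1 :: t) by rewrite /= q0.
have le' i : nth 0 (q.1 :: s) i <= nth 0 (q.1 :: t) i by case: i.
have t0' i : 0 <= nth 0 (q.1 :: t) i.
  have [i_lt|i_ge] := ltnP i (size (q.1 :: t)); first exact/(allP qt0)/mem_nth.
  by rewrite nth_default.
rewrite !pushE => -[|i] /=.
  have m'm : (m' <= m)%N by rewrite geq_minl.
  have -> : \sum_(x <- take m (q.1 :: t)) x =
    \sum_(x <- take m' (q.1 :: t)) x + \sum_(x <- drop m' (take m (q.1 :: t))) x.
    by rewrite -big_cat -{1}(cat_take_drop m' (take m _)) take_takel.
  have tl0 : 0 <= \sum_(x <- drop m' (take m (q.1 :: t))) x.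
    by apply/sum_nonneg/allP => x /mem_drop /mem_take /(allP qt0).
  apply: (@le_trans _ _ (\sum_(x <- take m' (q.1 :: t)) x)); last by lra.
  have s1 : size (take m' (q.1 :: s)) = m' by rewrite size_takel ?geq_minr.
  have s2 : size (take m' (q.1 :: t)) = m'.
    by rewrite size_takel // (leq_trans (geq_minr _ _)) //= ltnW.
  rewrite (big_nth 0) [in leRHS](big_nth 0) s1 s2 !big_mkord.
  by apply: ler_sum => j _; rewrite !nth_take.
rewrite !nth_drop; have [mle|mgt] := leqP m (size s).+1.
  by rewrite /m' (minn_idPl mle).
by rewrite nth_default // /m' (minn_idPr (ltnW mgt)) /= addSn leq_addr.
Qed.

(* The bottom file of t is dropped in s: as long as it is never merged, the
   rest of the stack is at least as costly as s with one slot less. *)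
Lemma merge_bottom_or_standalone K s t I sigma :
    is_instance I -> nonneg t -> (forall i, nth 0 s i <= nth 0 t i) ->
    (size s < size t)%N -> feasible K.+1 t I sigma ->
  \sum_(x <- t) x + total_length I <= merge_cost t I sigma \/
  exists2 tau, feasible K s I tau & merge_cost s I tau <= merge_cost t I sigma.
Proof.
elim: I s t sigma => [|q I IH] s t [|m sigma] //=; first by right; exists [::].
move=> /andP[/andP[q0 _] I0] t0 le sz /and3P[/andP[m0 mt] szK f].
set m' := minn m (size s).+1.
have p0 := push_nonneg m q0 t0.
have lep := push_dominated m q0 t0 le sz.
have hp : 0 <= head 0 (push m q t).
  by apply: le_trans q0 _; apply: head_push_ge.
(* Merging the bottom file of [t] costs the whole current length, and the later compactions cost at
   least the later requests. *)
have [full|part] := eqVneq m (size t).+1.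
  left; rewrite full push_full /= total_length_cons.
  have := merge_cost_ge I0 p0 f; rewrite full push_full; lra.
have szp : (size (push m' q s) < size (push m q t))%N.
  by rewrite !size_push /m'; move: sz mt part m0; lia.
have [h|[tau ftau ctau]] := IH _ _ _ I0 p0 lep szp f.
  left; move: h; rewrite sum_push total_length_cons; lra.
right; exists (m' :: tau) => /=.
  rewrite ftau andbT leq_min m0 /= geq_minr /= -ltnS.
  exact: leq_trans szp szK.
rewrite lerD //; exact: (lep 0%N).
Qed.


(** Each choice depends only on the requests handled so far; onlineness of [BRB] rests on this. *)
Lemma phases_prefix K1 (B : algorithm R) past cur k I J : exists tau,
  phases K1 B past cur k (I ++ J) = phases K1 B past cur k I ++ tau.
Proof.
elim: I past cur k => [|q I IH] past cur k /=; first by eexists.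
by case: ifP => _; [have [tau ->] := IH (rcons past q) [::] 1%N
  | have [tau ->] := IH (rcons past q) (rcons cur q)
      (k.+1 - last 0 (B (rcons cur q))).+1]; exists tau.
Qed.

Lemma size_phases K1 (B : algorithm R) past cur k I :
  size (phases K1 B past cur k I) = size I.
Proof.
by elim: I past cur k => [|q I IH] past cur k //=; case: ifP => _ /=; rewrite IH.
Qed.

Lemma size_BRB K I : size (@BRB R K I) = size I.
Proof. by case: K => [|[|K]]; rewrite /= ?size_mkseq // size_phases. Qed.

Lemma BRB_prefix K I J : exists tau, BRB K (I ++ J) = BRB K I ++ tau.
Proof.
case: K => [|[|K]] /=; last exact: phases_prefix.
all: by eexists; rewrite /merge_all /mkseq size_cat iotaD map_cat.
Qed.

Lemma BRB_rcons K I q : exists m, BRB K (rcons I q) = rcons (BRB K I) m.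
Proof.
have [tau e] := BRB_prefix K I [:: q].
have := size_BRB K (I ++ [:: q]).
rewrite e !size_cat size_BRB /= => /addnI; case: tau e => [|m []] // e _.
by exists m; rewrite -!cats1 e.
Qed.

Lemma BRB_online K : is_online (@BRB R K).
Proof.
move=> I J t _ _ tI tJ e.
have pre I' : (t < size I')%N ->
    nth 0%N (@BRB R K I') t = nth 0%N (BRB K (take t.+1 I')) t.
  move=> tI'; have [tau] := BRB_prefix K (take t.+1 I') (drop t.+1 I').
  by rewrite cat_take_drop => ->; rewrite nth_cat size_BRB size_takel // ltnSn.
by rewrite pre // e -pre.
Qed.

(** Real-valued competitiveness, bundled with feasibility because the recursion on [K] needs
    both. *)
Definition optimal_up_to K (B : algorithm R) := forall I, is_instance I ->
  feasible K [::] I (B I) /\ forall sigma, feasible K [::] I sigma ->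
    merge_cost [::] I (B I) <= K%:R * merge_cost [::] I sigma.

(** With one slot already occupied, every request must be merged with the stored file. *)
Lemma feasible1 s I sigma : size s = 1%N ->
  feasible 1 s I sigma = (sigma == nseq (size I) 2%N).
Proof.
elim: I s sigma => [|q I IH] s [|m sigma] //= s1.
rewrite size_push s1 !eqseq_cons; have [->|m2] := eqVneq m 2%N.
  by rewrite /= IH ?size_push ?s1.
by apply/negbTE/negP => /and3P[]; move: m2; lia.
Qed.

Lemma merge_all_cons q I :
  merge_all (q :: I) = 1%N :: nseq (size I) 2%N.
Proof.
rewrite /merge_all /mkseq /=; congr (_ :: _).
apply: (@eq_from_nth _ 0%N); first by rewrite size_map size_iota size_nseq.
move=> i; rewrite size_map size_iota => i_lt.
by rewrite (nth_map 0%N) ?size_iota // nth_iota // nth_nseq i_lt.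
Qed.

Lemma merge_all_optimal : optimal_up_to 1 (@merge_all R).
Proof.
move=> [|q I] I0.
  by split=> // -[|//] _; rewrite mul1r.
have s1 m : (0 < m)%N -> size (push m q [::]) = 1%N.
  by rewrite size_push; case: m.
rewrite merge_all_cons; split; first by rewrite /= s1 //= feasible1 ?s1.
move=> [|m sigma] //= /and3P[/andP[m0 m1] _].
have -> : m = 1%N by lia.
by rewrite feasible1 ?s1 // => /eqP->; rewrite mul1r.
Qed.

Section Phases.
Variables (K1 : nat) (B : algorithm R).
Hypotheses (K1_gt0 : (0 < K1)%N) (B_nil : B [::] = [::]).
Hypothesis B_rcons : forall I q, exists m, B (rcons I q) = rcons (B I) m.
Hypothesis B_opt : optimal_up_to K1 B.

(* In a completed phase ending with total length L, the recursive part costs at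
   most K1 * L and the final merge L, while an optimal schedule pays at least L:
   either it merges everything at some point of the phase, or it serves the
   phase on K1 slots only, at a cost of at least B / K1 >= L. *)
Lemma phases_competitive todo p cur :
    p != [::] -> is_instance (p ++ cur ++ todo) ->
    merge_cost [::] cur (B cur) <= K1%:R * total_length (p ++ cur) ->
  let S := rcons (run [::] cur (B cur)) (total_length p) in
  let ph := phases K1 B (p ++ cur) cur (size S) todo in
  feasible K1.+1 S todo ph /\
  forall t sigma, nonneg t -> t != [::] -> \sum_(x <- t) x = total_length p ->
    feasible K1.+1 t (cur ++ todo) sigma ->
    merge_cost [::] cur (B cur) + merge_cost S todo ph <=
      K1.+1%:R * merge_cost t (cur ++ todo) sigma.
Proof.
have K1R : 1 <= K1%:R :> R by rewrite ler1n.
have KS : K1.+1%:R = K1%:R + 1 :> R by rewrite -natr1.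
have phase_lb p' cur' t sigma : is_instance (p' ++ cur') -> nonneg t ->
    t != [::] -> \sum_(x <- t) x = total_length p' ->
    feasible K1.+1 t cur' sigma ->
    total_length (p' ++ cur') <= merge_cost t cur' sigma \/
    merge_cost [::] cur' (B cur') <= K1%:R * merge_cost t cur' sigma.
  rewrite is_instance_cat => /andP[_ c0] t0 tn st f.
  have le i : nth 0 [::] i <= nth 0 t i :> R.
    rewrite nth_nil; have [i_lt|i_ge] := ltnP i (size t).
      exact/(allP t0)/mem_nth.
    by rewrite nth_default.
  have sz : (size ([::] : seq R) < size t)%N by case: (t) tn.
  have [h|[tau ftau ctau]] := merge_bottom_or_standalone c0 t0 le sz f.
    by left; rewrite total_length_cat -st.
  right; apply: le_trans (proj2 (B_opt c0) _ ftau) _.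
  by rewrite ler_wpM2l.
elim: todo p cur => [|q todo IH] p cur pn I0 hcur S ph.
  split=> // t sigma t0 tn st; rewrite cats0 in I0 * => f.
  rewrite addr0 KS.
  have c0 : 0 <= merge_cost t cur sigma.
    by apply: merge_cost_ge0 f => //; move: I0; rewrite is_instance_cat => /andP[].
  (* Last, unfinished phase: [hcur] bounds the cost of [B] in the first case, [phase_lb] bounds it
     directly in the second. *)
  have [h|h] := phase_lb _ _ _ _ I0 t0 tn st f; last nra.
  apply: le_trans hcur _; nra.
move: I0; rewrite -cat_rcons => I0.
set cur' := rcons cur q in I0 *.
have [p0 cur'0 todo0] : [/\ is_instance p, is_instance cur' & is_instance todo].
  by move: I0; rewrite !is_instance_cat => /and3P[].
have [cur0 /andP[q0 _]] : is_instance cur /\ (0 <= q.1) && (0 <= q.2).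
  by move: cur'0; rewrite is_instance_rcons => /andP[].
have [fcur _] := B_opt cur0; have [fcur' _] := B_opt cur'0.
have [m Bm] := B_rcons cur q; rewrite -/cur' in Bm.
have szB := feasible_size fcur.
have tot : total_length (p ++ cur') = total_length (p ++ cur) + q.1.
  by rewrite /cur' -cats1 catA total_length_cat /total_length big_seq1.
rewrite /ph /= rcons_cat -/cur' cost_cap_feasible // lee_fin.
have -> : nilp (p ++ cur) = false by case: (p) pn.
rewrite /=; case: ifP => cond.
  have -> : push (size S).+1 q S = [:: total_length (p ++ cur')].
    rewrite push_full tot total_length_cat /S -cats1 big_cat big_seq1 /=.
    by rewrite (run_sum fcur) big_nil; congr [:: _]; ring.
  have [] := IH (p ++ cur') [::].
  - by case: (p) pn.
  - by rewrite cat0s -catA.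
  - rewrite B_nil cats0 mulr_ge0 ?total_length_ge0 ?is_instance_cat ?p0 //.
  rewrite cats0 B_nil /= => fph bound; split.
    by rewrite fph leqnn.
  move=> t sigma t0 tn st /feasible_catE[s1 [s2 [-> sz1 f1 f2]]].
  have := bound (run t cur' s1) s2 (run_nonneg _ cur'0 t0) (run_neq_nil _ _ tn).
  rewrite (run_sum f1) st -total_length_cat => /(_ erefl f2); rewrite add0r.
  rewrite merge_cost_cat // => le2.
  have pc0 : is_instance (p ++ cur') by rewrite is_instance_cat p0.
  have lb : total_length (p ++ cur') <= merge_cost t cur' s1.
    have [//|h] := phase_lb _ _ _ _ pc0 t0 tn st f1.
    by rewrite -(ler_pM2l (lt_le_trans ltr01 K1R)) (le_trans cond).
  (* The final merge replaces the compaction of [B] for [q], so [B] is charged only for [cur], where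
     [hcur] applies. *)
  have le3 : merge_cost [::] cur (B cur) <= K1%:R * merge_cost t cur' s1.
    by rewrite (le_trans hcur) // ler_wpM2l // (le_trans _ lb) // tot lerDl.
  by move: le2 => /=; rewrite KS; lra.
(* The phase goes on: the choice [m] of [B] is legal without the bottom file and therefore leaves it
   in place. *)
have fcur2 : feasible K1 (run [::] cur (B cur)) [:: q] [:: m].
  move: fcur'; rewrite /cur' -cats1 in Bm *.
  by rewrite Bm -cats1 feasible_cat // => /andP[].
have /= /and3P[/andP[m0 m1] szK _] := fcur2.
have r' : run [::] cur' (B cur') = push m q (run [::] cur (B cur)).
  by rewrite Bm /cur' -!cats1 run_cat.
have c' : merge_cost [::] cur' (B cur') =
    merge_cost [::] cur (B cur) + head 0 (push m q (run [::] cur (B cur))).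
  by rewrite Bm /cur' -!cats1 merge_cost_cat //= addr0.
have pS : push m q S = rcons (run [::] cur' (B cur')) (total_length p).
  by rewrite r' /S push_rcons.
have hS : head 0 (push m q S) = head 0 (push m q (run [::] cur (B cur))).
  by rewrite /S push_rcons // pushE.
have [] := IH p cur' pn.
- by [].
- by apply/ltW; rewrite ltNge cond.
rewrite -pS size_push Bm last_rcons => fph bound.
split.
  rewrite fph andbT /S size_rcons leqW //= m0 /=.
  by rewrite push_rcons // size_rcons ltnS.
move=> t sigma t0 tn st f; apply: le_trans (bound t sigma t0 tn st f).
by rewrite -Bm c' -hS; lra.
Qed.

End Phases.
Lemma BRB_optimal K : (0 < K)%N -> optimal_up_to K (@BRB R K).
Proof.
elim: K => [//|[|K1] IH] _; first exact: merge_all_optimal.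
move=> [|q I] I0.
  by split=> // -[|//] _; rewrite mulr0.
have B_nil : @BRB R K1.+1 [::] = [::] by case: (K1).
have [q0 I0'] : 0 <= q.1 /\ is_instance I by move: I0 => /andP[/andP[]].
have tq : total_length [:: q] = q.1 by rewrite /total_length big_seq1.
have p1 : push 1 q [::] = [:: q.1].
  by rewrite (push_full q [::]) big_nil addr0.
(* Every schedule has stack [[:: q.1]] after the first request, at the same cost; the phase
   invariant starts there with [cur] empty. *)
have := phases_competitive (ltn0Sn K1) B_nil (BRB_rcons K1.+1) (IH isT)
  (isT : [:: q] != [::]) (I0 : is_instance ([:: q] ++ [::] ++ I)).
rewrite B_nil tq cats0 => /(_ (mulr_ge0 (ler0n _ _) q0)) /= [fph bound].
rewrite p1 /= fph; split=> // -[|m sigma] //= /and3P[/andP[m0 m1] _].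
have -> : m = 1%N by lia.
rewrite p1 => /(bound [:: q.1] sigma).
rewrite /= q0 big_seq1 add0r => /(_ isT isT erefl) le.
apply: le_trans (lerD (lexx _) le) _.
by rewrite mulrDr lerD2r ler_peMl // ler1n.
Qed.

Lemma BRB_algorithm K : (0 < K)%N -> is_algorithm (@BRB R K).
Proof.
by move=> K0 I /(BRB_optimal K0)[f _]; exact: feasible_schedule f.
Qed.

Lemma BRB_competitive K : (0 < K)%N ->
  competitive (@cap R K) K%:R (@BRB R K).
Proof.
move=> K0 I /(BRB_optimal K0)[f le]; rewrite cost_cap_feasible //.
have K0R : 0 < K%:R :> R by rewrite ltr0n.
rewrite -lee_pdivrMl // -EFinM; apply: le_OPT => sigma fs.
by rewrite ler_pdivrMl //; exact: le.
Qed.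

End UpperBound.

(** * Offline schedules as composable transitions between stacks *)

Section Serve.
Variable R : realType.
Implicit Types (s t : seq R) (I J : seq (request R)) (q : request R) (x y w z : R)
  (K : nat).

Definition serve K s I t x :=
  exists sigma,
    [/\ feasible K s I sigma, run s I sigma = t & merge_cost s I sigma = x].

Lemma serve_nil K s : serve K s [::] s 0.
Proof. by exists [::]. Qed.

Lemma serve_cat K s t u I J x y : serve K s I t x -> serve K t J u y ->
  serve K s (I ++ J) u (x + y).
Proof.
move=> [sigma [f1 r1 c1]] [tau [f2 r2 c2]]; exists (sigma ++ tau).
have sz := feasible_size f1.
by rewrite feasible_cat // run_cat // merge_cost_cat // r1 f1 r2 c1 c2.
Qed.

Lemma serve_cons K s t m q I y : (0 < m <= (size s).+1)%N ->
    (size (push m q s) <= K)%N -> serve K (push m q s) I t y ->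
  serve K s (q :: I) t (head 0 (push m q s) + y).
Proof.
by move=> mP sz [sigma [f r c]]; exists (m :: sigma); rewrite /= mP sz f r c.
Qed.

Lemma serve_frame K s t I x z : serve K s I t x ->
  serve K.+1 (rcons s z) I (rcons t z) x.
Proof.
move=> [sigma [f r c]]; have [f' r' c'] := feasible_frame z f.
by exists sigma; rewrite f' r' c' r c.
Qed.

Lemma serve_sum K s t I x : serve K s I t x ->
  \sum_(y <- t) y = \sum_(y <- s) y + total_length I.
Proof. by move=> [sigma [/run_sum <- <-]]. Qed.

Lemma serve_ge_total K s t I x : is_instance I -> nonneg s ->
  serve K s I t x -> total_length I <= x.
Proof. by move=> I0 s0 [sigma [f _ <-]]; exact: merge_cost_ge f. Qed.

(** Buying: [q] triggers a merge of everything into one bottom file, and [I] is served on the [K]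
    slots above it. *)
Lemma serve_merging_all K s t q I y : serve K [::] I t y ->
  serve K.+1 s (q :: I) (rcons t (q.1 + \sum_(z <- s) z))
    (q.1 + \sum_(z <- s) z + y).
Proof.
move=> /(serve_frame (q.1 + \sum_(z <- s) z)) h.
have e := push_full q s.
have -> : q.1 + \sum_(z <- s) z = head 0 (push (size s).+1 q s) by rewrite e.
by apply: serve_cons; rewrite ?ltnSn // e.
Qed.

(** Renting: [z] stays untouched and the leftovers [s] join [q] in a file of length at most
    [c * q.1]; [merge_cost_scale] bounds the rest. *)
Lemma serve_keeping_bottom c K s t q I x z : 1 <= c -> is_instance I ->
    q.1 + \sum_(y <- s) y <= c * q.1 -> serve K [::] (q :: I) t x ->
  exists t' x', serve K.+1 (rcons s z) (q :: I) (rcons t' z) x' /\ x' <= c * x.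
Proof.
move=> c1 I0 sc [[|m sigma] [//= /and3P[/andP[m0 m1] szK f] _ <-]].
have {m0 m1} m1 : m = 1%N by lia.
have p1 : push 1 q [::] = [:: q.1] by rewrite (push_full q [::]) big_nil addr0.
rewrite m1 p1 in szK f *.
set w := q.1 + _ in sc.
have le i : nth 0 [:: w] i <= c * nth 0 [:: q.1] i.
  by case: i => [|i] //=; rewrite nth_nil mulr0.
have sz1 : size [:: w] = size [:: q.1] by [].
have [f' cost'] := merge_cost_scale c1 I0 sz1 le f.
exists (run [:: w] I sigma), (w + merge_cost [:: w] I sigma); split.
  have e : push (size s).+1 q (rcons s z) = rcons [:: w] z.
    by rewrite push_rcons // push_full.
  have := @serve_cons K.+1 (rcons s z) (rcons (run [:: w] I sigma) z)
    (size s).+1 q I (merge_cost [:: w] I sigma).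
  rewrite e size_rcons; apply=> //; first by rewrite ltnS leqnSn.
  by apply: serve_frame; exists sigma.
by rewrite /= mulrDr lerD.
Qed.

End Serve.

(** * The lower bound: an adversary against any online algorithm *)

Section LowerBound.
Variable R : realType.
Implicit Types (s t S T : seq R) (H I J W : seq (request R)) (q : request R)
  (a b d e x y w z : R).

(** One phase offline: [beta] opens it, [a] is what the algorithm pays before merging into the file
    of length about [b], [x] the cost of renting, [y] that of serving [J] after buying, [T] tiny
    leftovers. As [k * x] is about [a], the cheaper option [min(x, b)] satisfies
    [(k + 1) * min(x, b) <= k * x + b], about [a + b]. *)
Lemma serve_phase k d b beta a x y T z t J :
    0 < d <= 1 -> 0 < b -> 0 < beta -> 6 * k.+1%:R * beta <= d / 3 * b ->
    is_instance J -> 0 <= \sum_(u <- T) u <= d / 6 * beta -> b <= z ->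
    \sum_(u <- rcons T z) u <= b + d / 6 * beta -> 0 <= a ->
    serve k [::] J t y -> y <= beta ->
    k%:R * x <= (1 + d / 3) * a + 3 * k%:R * beta ->
    ((0 < k)%N -> exists t', serve k [::] ((beta, 0) :: J) t' x) ->
  exists T' z' x',
    [/\ serve k.+1 (rcons T z) ((beta, 0) :: J) (rcons T' z') x', b <= z',
        x' <= 2 * b & k.+1%:R * x' <= (1 + d) * (a + b)].
Proof.
move=> /andP[d0 d1] b0 beta0 small J0 /andP[T0 Tle] zb le a0 cheap ybeta xle rent.
have kS : k.+1%:R = k%:R + 1 :> R by rewrite -natr1.
have k0 : 0 <= k%:R :> R by [].
rewrite kS in small *.
have kbeta0 : 0 <= k%:R * beta by rewrite mulr_ge0 // ltW.
have dbeta : d * beta <= beta by rewrite ler_piMl // ltW.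
have db : d * b <= b by rewrite ler_piMl // ltW.
have da0 : 0 <= d * a by rewrite mulr_ge0 // ltW.
(* Rent if possible and no dearer than [b]; the errors fit since
   [(1 + d / 6) * (1 + d / 3) <= 1 + d]. *)
have [/andP[kpos xb]|buy] := boolP ((0 < k)%N && (x <= b)).
  have [t' rent'] := rent kpos.
  have c1 : 1 <= 1 + d / 6 by lra.
  have fits : (beta, 0 : R).1 + \sum_(u <- T) u <= (1 + d / 6) * (beta, 0 : R).1.
    by rewrite /=; lra.
  have [t2 [x2 [h2 le2]]] := serve_keeping_bottom z c1 J0 fits rent'.
  exists t2, z, x2; split=> //; first nra.
  have h3 : (k%:R + 1) * x <= (1 + d / 3) * (a + b) by lra.
  have h4 : (k%:R + 1) * x2 <= (1 + d / 6) * ((k%:R + 1) * x) by nra.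
  apply: le_trans h4 _.
  apply: le_trans (ler_wpM2l _ h3) _; first lra.
  rewrite mulrA ler_wpM2r ?addr_ge0 // 1?ltW //; nra.
have sT : \sum_(u <- rcons T z) u = \sum_(u <- T) u + z.
  by rewrite -cats1 big_cat big_seq1.
exists t, (beta + \sum_(u <- rcons T z) u), (beta + \sum_(u <- rcons T z) u + y).
split.
- exact: (serve_merging_all (rcons T z) ((beta, 0) : request R) cheap).
- by rewrite sT; lra.
- lra.
have kb : k%:R * b <= k%:R * x.
  move: buy; rewrite negb_and -ltNge -eqn0Ngt => /orP[/eqP->|/ltW bx].
    by rewrite !mul0r.
  by rewrite ler_wpM2l.
set s := \sum_(u <- rcons T z) u in le *.
(* Buying costs [b] up to [3 * beta], which [small] makes negligible. *)
have : (k%:R + 1) * (beta + s + y) <= (k%:R + 1) * (b + 3 * beta).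
  by rewrite ler_wpM2l //; lra.
lra.
Qed.

Section Adversary.
Variables (K : nat) (A : algorithm R).
Hypothesis A_online : is_online A.
Hypothesis A_feasible : forall I, is_instance I -> feasible K [::] I (A I).

Let stk I := run [::] I (A I).
Let cst I := merge_cost [::] I (A I).

(** Onlineness makes the choices on [H] a prefix of those on [rcons H q], so the adversary can react
    to them. *)
Lemma online_step H q : is_instance (rcons H q) -> exists m,
  [/\ (0 < m <= (size (stk H)).+1)%N, (size (push m q (stk H)) <= K)%N,
      stk (rcons H q) = push m q (stk H)
    & cst (rcons H q) = cst H + head 0 (push m q (stk H))].
Proof.
move=> I0; have f := A_feasible I0.
have H0 : is_instance H by move: I0; rewrite is_instance_rcons => /andP[].
have fH := A_feasible H0.
have szH := feasible_size fH.
have [m e] : exists m, A (rcons H q) = A H ++ [:: m].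
  have sz := feasible_size f; rewrite size_rcons in sz.
  exists (nth 0%N (A (rcons H q)) (size H)).
  apply: (@eq_from_nth _ 0%N); rewrite ?size_cat ?szH ?sz ?addn1 //.
  move=> i; rewrite ltnS leq_eqVlt nth_cat szH => /orP[/eqP->|i_lt].
    by rewrite ltnn subnn.
  rewrite i_lt; apply: A_online => //; first by rewrite size_rcons leqW.
  by rewrite -cats1 takel_cat.
exists m; move: f; rewrite /stk /cst e -cats1.
rewrite feasible_cat // run_cat // merge_cost_cat //= addr0.
by case/andP=> _ /andP[-> /andP[-> _]].
Qed.

(* An adversary for k free slots ends either when the algorithm merges into one
   of the files of the stack S it started from, paying x for this (not counted
   in a), or when the algorithm has paid M. *)
Definition adversary_ends M H J a :=
  (exists x i, [/\ (0 < i <= size (stk H))%N,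
      stk (H ++ J) = x :: drop i (stk H), \sum_(u <- take i (stk H)) u <= x
    & cst H + a + x <= cst (H ++ J)])
  \/ (cst H + a <= cst (H ++ J) /\ M <= a).

(* J follows the file of length b; a is what the algorithm pays and x what an
   offline schedule on k slots pays. The second conjunct is what makes "buy"
   cheap: once the file of length b has been merged away, J is almost free. For
   k = 0 no schedule exists and x is irrelevant. *)
Definition adversary k := forall d b e M H,
  0 < d <= 1 -> 0 < b -> 0 < e -> is_instance H ->
  (size (stk H) + k)%N = K ->
  exists J a x, [/\ is_instance J /\ 0 <= a,
    exists t y, serve k [::] J t y /\ y <= e,
    k%:R * x <= (1 + d) * a + 3 * k%:R * b,
    (0 < k)%N -> exists t, serve k [::] ((b, 0) :: J) t x
    & adversary_ends M H ((b, 0) :: J) a].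

(** The stack is full, so a single push forces a merge into an old file. *)
Lemma adversary0 : adversary 0.
Proof.
move=> d b e M H _ b0 e0 H0 szS; rewrite addn0 in szS.
have I0 : is_instance (rcons H (b, 0)).
  by rewrite is_instance_rcons H0 /= (ltW b0) lexx.
have [m [/andP[m0 m1] szK stkE cstE]] := online_step I0.
exists [::], 0, 0; split=> //.
- by exists [::], 0; split; [exact: serve_nil | exact: ltW].
- by rewrite !mul0r !mulr0 mul0r addr0.
(* [m] also counts the new file, hence [m.-1] old ones. *)
left; exists (head 0 (push m (b, 0) (stk H))), m.-1.
move: szK m1 m0; rewrite size_push.
case: m stkE cstE => [|[|m]] stkE cstE szK m1 m0 //; first by move: szS szK; lia.
rewrite cats1 stkE cstE !addr0 pushE /=; split=> //.
by rewrite big_cons lerDr ltW.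
Qed.

Section Phases.
Variables (k : nat) (d b M : R) (H : seq (request R)).
Hypotheses (IHk : adversary k) (d01 : 0 < d <= 1) (b0 : 0 < b).
Hypothesis (H0 : is_instance H).
Hypothesis (szS : (size (stk H) + k.+1)%N = K).

(** State after [n] phases: the algorithm holds everything since [b] in one file [y] and has paid at
    least [b] per phase. Offline, one schedule serves all of it, with a bottom file [z]; another
    serves [W] alone cheaply, for use after an outer buy. *)
Let running n beta := exists W a x y z T t v,
  [/\ is_instance W,
      [/\ stk (H ++ (b, 0) :: W) = y :: stk H, b <= y, n%:R * b <= a
        & cst H + a <= cst (H ++ (b, 0) :: W)],
      [/\ serve k.+1 [::] ((b, 0) :: W) (rcons T z) x, b <= z
        & k.+1%:R * x <= (1 + d) * a + k.+1%:R * b]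
    & serve k.+1 [::] W t v /\ v <= 4 * beta].

(** What [adversary k.+1] must deliver, with [4 * beta] in place of [e]. *)
Let finished beta := exists W a x,
  [/\ is_instance W /\ 0 <= a,
    exists t y, serve k.+1 [::] W t y /\ y <= 4 * beta,
    k.+1%:R * x <= (1 + d) * a + 3 * k.+1%:R * b,
    exists t, serve k.+1 [::] ((b, 0) :: W) t x
    & adversary_ends M H ((b, 0) :: W) a].

Let finished_le beta beta' : beta <= beta' -> finished beta -> finished beta'.
Proof.
move=> le [W [a [x [h1 [t [y [h2 h3]]] h4 h5 h6]]]].
exists W, a, x; split=> //; exists t, y; split=> //.
by apply: le_trans h3 _; rewrite ler_wpM2l.
Qed.

Let phases_start beta : 0 < beta -> finished beta \/ running 0 beta.
Proof.
move=> beta0; have I0 : is_instance (rcons H (b, 0)).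
  by rewrite is_instance_rcons H0 /= (ltW b0) lexx.
have [m [/andP[m0 m1] szK stkE cstE]] := online_step I0.
have first : serve k.+1 [::] [:: (b, 0)] [:: b] b.
  have p1 : push 1 (b, 0) [::] = [:: b].
    by rewrite (push_full (b, 0) [::]) big_nil addr0.
  have := @serve_cons _ k.+1 [::] [:: b] 1 (b, 0) [::] 0.
  by rewrite p1 /= addr0; apply=> //; exact: serve_nil.
have v0 : serve k.+1 [::] [::] [::] (0 : R) /\ 0 <= 4 * beta.
  by split; [exact: serve_nil | rewrite mulr_ge0 // ltW].
have [m1'|m_neq1] := eqVneq m 1%N.
  right; exists [::], 0, b, b, b, [::], [::], 0; split=> //.
    rewrite cats1 stkE cstE m1' pushE /= take0 big_seq1 drop0 mul0r addr0.
    split=> //.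
    by rewrite lerDl ltW.
  by split=> //; rewrite mulr0 add0r.
left; exists [::], 0, b; split=> //.
- by exists [::], 0.
- by rewrite mulr0 add0r ler_wpM2r ?(ltW b0) // ler_peMl // ler1n.
- by exists [:: b].
left; exists (head 0 (push m (b, 0) (stk H))), m.-1.
case: m m_neq1 stkE cstE {szK} m1 m0 => [|[|m]] // _ stkE cstE m1 m0.
rewrite cats1 stkE cstE !addr0 pushE /=; split=> //.
by rewrite big_cons lerDr ltW.
Qed.

(** Play [adversary k] above [y]. A merge into [y] alone completes a phase; a merge reaching the old
    stack, or a payment of [M], finishes the game. *)
Let phases_step n beta theta : 0 < beta -> theta = d / 24 ->
    6 * k.+1%:R * beta <= d / 3 * b -> running n (theta * beta) ->
  finished beta \/ running n.+1 beta.
Proof.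
move=> beta0 thetaE small.
move=> [W [a [x [y [z [T [t [v]]]]]]]].
move=> [W0 [stkE yb ale cstE] [main zb xle] [cheap vle]].
have /andP[d0 d1] := d01.
have dbeta : d * beta <= beta by rewrite ler_piMl // ltW.
have db0 : 0 < d * beta by rewrite mulr_gt0.
have db : d * b <= b by rewrite ler_piMl // ltW.
have dbb0 : 0 < d * b by rewrite mulr_gt0.
(* [theta] is chosen so that [4 * theta * beta] is the leftover bound of [serve_phase]. *)
have vle' : v <= d / 6 * beta by move: vle; rewrite thetaE; lra.
have totW0 := total_length_ge0 W0.
have totW : total_length W <= v by exact: serve_ge_total cheap.
have bW0 : is_instance ((b, 0) :: W) by rewrite is_instance_cons W0 /= ltW ?lexx.
have a0 : 0 <= a by apply: le_trans ale; rewrite mulr_ge0 // ltW.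
pose H' := H ++ (b, 0) :: W.
have H'0 : is_instance H' by rewrite is_instance_cat H0.
have szS' : (size (stk H') + k)%N = K by rewrite /H' stkE -szS /= addSnnS.
have d301 : 0 < d / 3 <= 1 by apply/andP; split; lra.
have [J [a1 [x1 [[J0 a10] [t1 [y1 [cheap1 y1le]]] x1le rent ends]]]] :=
  IHk M d301 beta0 beta0 H'0 szS'.
have bJ0 : is_instance ((beta, 0) :: J) by rewrite is_instance_cons J0 /= ltW ?lexx.
pose W' := W ++ (beta, 0) :: J.
have W'0 : is_instance W' by rewrite is_instance_cat W0.
have H'J : H' ++ (beta, 0) :: J = H ++ (b, 0) :: W' by rewrite /H' -catA.
have sumTz : \sum_(u <- rcons T z) u = b + total_length W.
  by rewrite (serve_sum main) big_nil add0r total_length_cons.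
have sumT : \sum_(u <- rcons T z) u = \sum_(u <- T) u + z.
  by rewrite -cats1 big_cat big_seq1.
have T0 : 0 <= \sum_(u <- T) u.
  have [sigma [_ rE _]] := main.
  have := run_nonneg sigma bW0 (isT : nonneg ([::] : seq R)).
  by rewrite rE /nonneg all_rcons => /andP[_ /sum_nonneg].
have Tle : 0 <= \sum_(u <- T) u <= d / 6 * beta.
  by rewrite T0 /=; move: sumTz; rewrite sumT; lra.
have Tzle : \sum_(u <- rcons T z) u <= b + d / 6 * beta by lra.
have [T' [z' [x' [main1 z'b x'2b x'le]]]] := serve_phase d01 b0 beta0 small J0 Tle
  zb Tzle a10 cheap1 y1le x1le rent.
have main' := serve_cat main main1; rewrite -/W' cat_cons in main'.
(* Serve [W] cheaply, merge its remains with [beta], then serve [J] cheaply. *)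
have cheap' : exists t' v', serve k.+1 [::] W' t' v' /\ v' <= 4 * beta.
  have cheap2 := serve_merging_all t ((beta, 0) : request R) cheap1.
  eexists; eexists; split; first exact: (serve_cat cheap cheap2).
  by rewrite (serve_sum cheap) big_nil /=; lra.
have k1 : 1 <= k.+1%:R :> R by rewrite ler1n.
(* The last phase may lack the closing payment of [b], so it is bounded by [2 * b]; with the initial
   [b] this is the slack of [3 * b]. *)
have xx'le : k.+1%:R * (x + x') <= (1 + d) * (a + a1) + 3 * k.+1%:R * b.
  have : k.+1%:R * x' <= k.+1%:R * (2 * b) by rewrite ler_wpM2l.
  have : 0 <= (1 + d) * a1 by rewrite mulr_ge0 //; lra.
  by rewrite !mulrDr; lra.
have stop : adversary_ends M H ((b, 0) :: W') (a + a1) -> finished beta.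
  move=> E; exists W', (a + a1), (x + x'); split=> //.
    by rewrite addr_ge0.
  by eexists; exact: main'.
case: ends => [[u [i [/andP[i0 ile] stkE' ule cstE']]]|[cstE' Mle]]; last first.
  left; apply: stop; right; rewrite -H'J.
  by split; lra.
rewrite H'J in stkE' cstE'; rewrite stkE in ile stkE' ule.
(* The count [i] includes [y]: for 1 only [y] is merged, at a cost of at least [b]; beyond that, old
   files are too. *)
case: i i0 ile stkE' ule => [//|[|i]] _ ile stkE' ule.
  right; move: stkE' ule; rewrite /= drop0 take0 big_seq1 => stkE' ule.
  have [t' [v' [h1 h2]]] := cheap'.
  exists W', (a + a1 + b), (x + x'), u, z', T', t', v'; split=> //.
    split=> //; first lra.
      by rewrite -natr1; lra.
    by rewrite -/H' in cstE; lra.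
  by split=> //; rewrite !mulrDr in x'le *; lra.
left; apply: stop; left; exists u, i.+1; split=> //.
  by move: ule; rewrite /= big_cons; lra.
by rewrite -/H' in cstE; lra.
Qed.

(** Lengths grow from phase to phase yet must stay small against [b], so [beta] is the scale of the
    last phase and the earlier ones are played at scale [d / 24 * beta]. *)
Let phases_run n beta : 0 < beta -> 6 * k.+1%:R * beta <= d / 3 * b ->
  finished beta \/ running n beta.
Proof.
have /andP[d0 d1] := d01.
elim: n beta => [|n IH] beta beta0 small; first exact: phases_start.
have lt0 : 0 < d / 24 * beta by rewrite mulr_gt0 // divr_gt0.
have le : d / 24 * beta <= beta by rewrite ler_piMl ?(ltW beta0) //; lra.
have small' : 6 * k.+1%:R * (d / 24 * beta) <= d / 3 * b.
  by apply: le_trans small; rewrite ler_wpM2l // mulr_ge0.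
have [/(finished_le le)|] := IH _ lt0 small'; first by left.
exact: phases_step.
Qed.

Lemma adversary_next e : 0 < e ->
  exists J a x, [/\ is_instance J /\ 0 <= a,
    exists t y, serve k.+1 [::] J t y /\ y <= e,
    k.+1%:R * x <= (1 + d) * a + 3 * k.+1%:R * b,
    (0 < k.+1)%N -> exists t, serve k.+1 [::] ((b, 0) :: J) t x
    & adversary_ends M H ((b, 0) :: J) a].
Proof.
move=> e0; have /andP[d0 d1] := d01.
have k0 : 0 < 6 * k.+1%:R :> R by rewrite mulr_gt0 // ltr0n.
(* The first bound keeps the cheap schedule within [e], the second is the smallness required by
   [phases_run]. *)
pose beta := Num.min (e / 4) (d / 3 * b / (6 * k.+1%:R)).
have beta0 : 0 < beta.
  by rewrite lt_min divr_gt0 //= divr_gt0 // mulr_gt0 // divr_gt0.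
have small : 6 * k.+1%:R * beta <= d / 3 * b.
  by rewrite mulrC -ler_pdivlMr // ge_min lexx orbT.
have betae : 4 * beta <= e.
  have : beta <= e / 4 by rewrite ge_min lexx.
  lra.
have [n Mn] : exists n, M <= n%:R * b.
  exists (Num.bound `|M / b|); rewrite -ler_pdivrMr // ltW //.
  by apply: le_lt_trans (ler_norm _) _; exact: archi_boundP.
have [] := phases_run n beta0 small.
  move=> [W [a [x [h1 [t [y [h2 h3]]] h4 h5 h6]]]].
  exists W, a, x; split=> //; exists t, y; split=> //.
  exact: le_trans h3 betae.
move=> [W [a [x [y [z [T [t [v]]]]]]]].
move=> [W0 [stkE yb ale cstE] [main zb xle] [cheap vle]].
have kb : 0 <= k.+1%:R * b by rewrite mulr_ge0 // ltW.
exists W, a, x; split.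
- by split=> //; apply: le_trans ale; rewrite mulr_ge0 // ltW.
- by exists t, v; split=> //; exact: le_trans vle betae.
- by lra.
- by exists (rcons T z).
- by right; split=> //; exact: le_trans Mn ale.
Qed.

End Phases.

Lemma adversary_all k : adversary k.
Proof.
elim: k => [|k IH]; first exact: adversary0.
by move=> d b e M H d01 b0 e0 H0 szS; exact: adversary_next.
Qed.

(** From an empty stack there is no old file to merge into, so the adversary can end only by the
    algorithm paying [M]. *)
Lemma online_lower_bound d M : 0 < d <= 1 -> (0 < K)%N ->
  exists I sigma, [/\ is_instance I, feasible K [::] I sigma,
    K%:R * merge_cost [::] I sigma <= (1 + d) * cst I + 3 * K%:R
    & M <= cst I].
Proof.
move=> d01 K0.
have [J [a [x [[J0 a0] _ xle [//|t [sigma [f _ xE]]] ends]]]] :=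
  @adversary_all K d 1 1 M [::] d01 ltr01 ltr01 isT (add0n K).
have [[? [[|i] []]]//|[]] := ends.
rewrite /cst /= add0r => aI Ma.
exists ((1, 0) :: J), sigma; split=> //.
- by rewrite is_instance_cons J0 /= ler01 lexx.
- rewrite xE; apply: le_trans xle _; rewrite mulr1 lerD2r ler_wpM2l //.
  by case/andP: d01; lra.
- exact: le_trans Ma aI.
Qed.

End Adversary.

(** * From the adversary to the competitive ratio *)

Lemma OPT_ge0 K I : is_instance I -> (0%:E <= OPT (@cap R K) I)%E.
Proof. by move=> I0; apply: le_OPT => sigma; exact: merge_cost_ge0. Qed.

Lemma no_better_than_K K (A : algorithm R) (c : R) : (0 < K)%N ->
    is_algorithm A -> is_online A -> c < K%:R ->
  exists I, is_instance I /\
    (c%:E * OPT (@cap R K) I < cost (@cap R K) I (A I))%E.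
Proof.
move=> K0 Aalg Aon.
wlog c0 : c / 0 <= c.
  move=> wl cK; have [c0|c_lt0] := leP 0 c; first exact: wl.
  have [||I [I0 lt]] := wl 0; rewrite ?ltr0n //.
  exists I; split=> //; apply: le_lt_trans lt.
  by apply: lee_wpmul2r; [exact: OPT_ge0 | rewrite lee_fin ltW].
move=> cK.
(* A legal schedule may still break the cap; its cost is then infinite, while [BRB] shows that [OPT]
   is finite. *)
have [[I [I0 /negbTE infeasible]]|feasibleA] :=
  EM (exists I, is_instance I /\ ~~ feasible K [::] I (A I)).
  exists I; split=> //; rewrite cost_cap ?infeasible; last exact: Aalg.
  have [f _] := BRB_optimal K0 I0.
  apply: (@le_lt_trans _ _ (c%:E * (merge_cost [::] I (BRB K I))%:E)%E).
    by apply: lee_wpmul2l; [rewrite lee_fin | exact: OPT_le].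
  by rewrite -EFinM ltry.
have Af I : is_instance I -> feasible K [::] I (A I).
  by move=> I0; apply/negPn/negP => nf; apply: feasibleA; exists I.
have K1 : 1 <= K%:R :> R by rewrite ler1n.
pose kappa := K%:R - c; have kappa0 : 0 < kappa by rewrite subr_gt0.
(* With this [d], [c * d * a <= kappa / 2 * a]; with this [M], the additive term [3 * c * K] stays
   strictly below the other half of [kappa * a]. *)
have [|I [sigma [I0 f le Mle]]] :=
    @online_lower_bound K A Aon Af (kappa / (2 * K%:R))
      (6 * K%:R ^+ 2 / kappa + 1) _ K0.
  rewrite divr_gt0 ?mulr_gt0 ?ltr0n //= ler_pdivrMr ?mulr_gt0 ?ltr0n //.
  by rewrite /kappa; lra.
exists I; split=> //; rewrite cost_cap_feasible ?Af //.
apply: (@le_lt_trans _ _ (c%:E * (merge_cost [::] I sigma)%:E)%E).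
  by apply: lee_wpmul2l; [rewrite lee_fin | exact: OPT_le].
rewrite -EFinM lte_fin.
set X := merge_cost _ _ _ in le *; set a := merge_cost _ _ (A I) in le Mle *.
have KR0 : 0 < K%:R :> R by rewrite ltr0n.
have dK : kappa / (2 * K%:R) * K%:R = kappa / 2 by field; lra.
have MK : 6 * K%:R ^+ 2 < kappa * a.
  have : kappa * (6 * K%:R ^+ 2 / kappa + 1) <= kappa * a by rewrite ler_pM2l.
  have -> : kappa * (6 * K%:R ^+ 2 / kappa + 1) = 6 * K%:R ^+ 2 + kappa.
    by field; lra.
  lra.
have a0 : 0 <= a.
  by apply: le_trans Mle; rewrite addr_ge0 // divr_ge0 ?(ltW kappa0) //
    mulr_ge0 // sqr_ge0.
set dd := kappa / (2 * K%:R) in le dK.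
have dd0 : 0 <= dd by rewrite divr_ge0 ?(ltW kappa0) // mulr_ge0 // ltW.
rewrite -(ltr_pM2l KR0).
have h1 : c * (K%:R * X) <= c * ((1 + dd) * a + 3 * K%:R) by rewrite ler_wpM2l.
have h2 : c * dd * a <= kappa / 2 * a.
  by rewrite ler_wpM2r // -dK mulrC ler_wpM2l // ltW.
have h3 : c * K%:R <= K%:R ^+ 2 by rewrite expr2 ler_wpM2r // ltW.
have cE : c = K%:R - kappa by rewrite /kappa; ring.
have h4 : c * a = K%:R * a - kappa * a by rewrite cE mulrBl.
lra.
Qed.

End LowerBound.

Theorem theorem1 (R : realType) (K : nat) (hK : (1 <= K)%N) :
  (is_algorithm (@BRB R K) /\ is_online (@BRB R K) /\
     competitive (@cap R K) K%:R (@BRB R K))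
  /\
  (forall A : algorithm R, is_algorithm A -> is_online A ->
     forall c : R, c < K%:R ->
     exists I : seq (request R), is_instance I /\
       (c%:E * OPT (@cap R K) I < cost (@cap R K) I (A I))%E).
Proof.
split; last by move=> A Aalg Aon c; exact: no_better_than_K.
split; first exact: BRB_algorithm.
by split; [exact: BRB_online | exact: BRB_competitive].
Qed.
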